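(* Let $\mathcal P=(p)^*$ be a periodic up-down sequence with period $p=(p_1,\dots,p_m)\in\{0,1\}^m$ of length $m>1$, and let $i_1<i_2<\dots<i_r$ be the locations of the zeros in $p$, where $i_r=m$. Let $r$ be even. Then the exponential generating function for the numbers $\sharp_n^{\mathcal P}$ is equal to $$1+\frac{\det\widetilde M^{\mathcal P}(t)}{\det M^{\mathcal P}(t)},$$ where $M^{\mathcal P}(t)$ is the $r\times r$ matrix $$M^{\mathcal P}(t)=\begin{pmatrix} \varphi_{m,0}&\varphi_{m,m-i_1}&\varphi_{m,m-i_2}&\cdots&\varphi_{m,m-i_{r-1}}\\ \varphi_{m,i_1}&\varphi_{m,0}&\varphi_{m,m+i_1-i_2}&\cdots&\varphi_{m,m+i_1-i_{r-1}}\\ \varphi_{m,i_2}&\varphi_{m,i_2-i_1}&\varphi_{m,0}&\cdots&\varphi_{m,m+i_2-i_{r-1}}\\ \vdots&\vdots&\vdots&\ddots&\vdots\\ \varphi_{m,i_{r-1}}&\varphi_{m,i_{r-1}-i_1}&\varphi_{m,i_{r-1}-i_2}&\cdots&\varphi_{m,0} \end{pmatrix}$$ and $\widetilde M^{\mathcal P}(t)$ is the $r\times r$ matrix $$\widetilde M^{\mathcal P}(t)=\begin{pmatrix} \psi_{m,0}&\psi_{m,1}&\psi_{m,2}&\cdots&\psi_{m,r-1}\\ \varphi_{m,i_1}&\varphi_{m,0}&\varphi_{m,m+i_1-i_2}&\cdots&\varphi_{m,m+i_1-i_{r-1}}\\ \varphi_{m,i_2}&\varphi_{m,i_2-i_1}&\varphi_{m,0}&\cdots&\varphi_{m,m+i_2-i_{r-1}}\\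 \vdots&\vdots&\vdots&\ddots&\vdots\\ \varphi_{m,i_{r-1}}&\varphi_{m,i_{r-1}-i_1}&\varphi_{m,i_{r-1}-i_2}&\cdots&\varphi_{m,0} \end{pmatrix}$$ with $$\psi_{m,j}=\varepsilon_{i_j+1}+\sum_{i\ne i_j}\varepsilon_{i+1}\,\varphi_{m,m+i-i_j}$$ and $\varphi_{m,j}=\varphi_{m,j}(t)$.
   Context: The up-down sequence of a permutation $\sigma=(\sigma_1,\dots,\sigma_n)$ of length $n$ is the binary vector of length $n-1$ whose $i$-th entry is $1$ if $\sigma_i<\sigma_{i+1}$ and $0$ otherwise. For a binary sequence $\mathcal P=(p_1,p_2,\dots)$, $\sharp_n^{\mathcal P}$ is the number of permutations of length $n$ whose up-down sequence is $(p_1,\dots,p_{n-1})$. The notation $(p)^*$ means the infinite periodic repetition of $p$, so $p_{i+m}=p_i$ for all $i\ge1$. The exponential generating function of the numbers $\sharp_n^{\mathcal P}$ is the series in $t$ with terms $\sharp_n^{\mathcal P}t^n/n!$. Signs: $\varepsilon_i=(-1)^{\bar p_1+\bar p_2+\dots+\bar p_{i-1}}$ for $i\ge1$, where $\bar p_k=1-p_k$ (so $\varepsilon_1=1$). The Olivier functions of the $m$-th order are $\varphi_{m,i}(t)=\sum_{j=0}^{\infty}\frac{t^{jm+i}}{(jm+i)!}$, $0\le i\le m-1$. In the formula for $\psi_{m,j}$, $0\le j\le r-1$, one puts $i_0=0$, the summation index $i$ ranges within $0,\dots,m-1$, and the second index of $\varphi_{m,\cdot}$ is understood modulo $m$.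
   Formalization: The printed equality fails at t^0 (right side 2; the empty permutation gives 1), e.g. p=(0,0): e^t versus 1+e^t; the formal claim equates coefficients of t^n for n≥1 only. The sum over i≠i_j in ψ is read as i outside {i_0,...,i_{r-1}}; the single-index reading already fails at t^1. *)

(* Defs.v *)
From HB Require Import structures.
From mathcomp Require Import all_boot all_order all_algebra all_fingroup.
From mathcomp Require Import boolp.
Set Implicit Arguments.
Unset Strict Implicit.
Unset Printing Implicit Defensive.
Import GRing.Theory.
Local Open Scope ring_scope.

(** * Formal power series in one variable t over a field *)

Record fps (R : fieldType) : Type := Fps { fcoef : nat -> R }.

Section FpsRing.
Variable R : fieldType.
Implicit Types a b c : fps R.

Lemma fpsP a b : (forall n, fcoef a n = fcoef b n) -> a = b.
Proof. by case: a b => [f] [g] /= fg; congr Fps; apply/funext. Qed.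

HB.instance Definition _ := gen_eqMixin (fps R).
HB.instance Definition _ := gen_choiceMixin (fps R).

Definition fps_zero : fps R := Fps (fun=> 0).
Definition fps_opp a : fps R := Fps (fun n => - fcoef a n).
Definition fps_add a b : fps R := Fps (fun n => fcoef a n + fcoef b n).

Lemma fps_addA : associative fps_add.
Proof. by move=> a b c; apply: fpsP => n /=; rewrite addrA. Qed.
Lemma fps_addC : commutative fps_add.
Proof. by move=> a b; apply: fpsP => n /=; rewrite addrC. Qed.
Lemma fps_add0 : left_id fps_zero fps_add.
Proof. by move=> a; apply: fpsP => n /=; rewrite add0r. Qed.
Lemma fps_addN : left_inverse fps_zero fps_opp fps_add.
Proof. by move=> a; apply: fpsP => n /=; rewrite addNr. Qed.

HB.instance Definition _ :=
  GRing.isZmodule.Build (fps R) fps_addA fps_addC fps_add0 fps_addN.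

Definition fps_one : fps R := Fps (fun n => (n == 0)%:R).
Definition fps_mul a b : fps R :=
  Fps (fun n => \sum_(i < n.+1) fcoef a i * fcoef b (n - i)).

Let trunc N a : {poly R} := \poly_(i < N) fcoef a i.

Let fps_mulE N n a b : (n < N)%N ->
  fcoef (fps_mul a b) n = (trunc N a * trunc N b)`_n.
Proof.
move=> nN; rewrite coefM /=; apply: eq_bigr => i _; rewrite !coef_poly.
by rewrite (leq_ltn_trans (leq_subr _ _) nN) (leq_ltn_trans (leq_ord i) nN).
Qed.

Lemma fps_mulC : commutative fps_mul.
Proof. by move=> a b; apply: fpsP => n; rewrite !(fps_mulE _ _ (leqnn _)) mulrC. Qed.

Let fps_mulEr n a b c :
  fcoef (fps_mul a (fps_mul b c)) n =
  (trunc n.+1 a * (trunc n.+1 b * trunc n.+1 c))`_n.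
Proof.
rewrite coefM /=; apply: eq_bigr => i _; rewrite coef_poly ltn_ord.
by congr (_ * _); apply: fps_mulE; rewrite ltnS leq_subr.
Qed.

Lemma fps_mulA : associative fps_mul.
Proof.
move=> a b c; apply: fpsP => n; rewrite [in RHS]fps_mulC !fps_mulEr.
by rewrite mulrA mulrC.
Qed.

Lemma fps_mul1 : left_id fps_one fps_mul.
Proof.
move=> a; apply: fpsP => n /=; rewrite big_ord_recl /= mul1r subn0.
by rewrite big1 ?addr0 // => i _; rewrite mul0r.
Qed.

Lemma fps_mulDl : left_distributive fps_mul fps_add.
Proof.
move=> a b c; apply: fpsP => n /=; rewrite -big_split /=.
by apply: eq_bigr => i _; rewrite mulrDl.
Qed.

Lemma fps_one_neq0 : fps_one != fps_zero.
Proof.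
apply/eqP => /(congr1 (fun a => fcoef a 0)) /= /eqP.
by rewrite oner_eq0.
Qed.

HB.instance Definition _ := GRing.Zmodule_isComNzRing.Build (fps R)
  fps_mulA fps_mulC fps_mul1 fps_mulDl fps_one_neq0.

Fixpoint fps_inv_seq a n : seq R :=
  if n is n'.+1 then
    let s := fps_inv_seq a n' in
    rcons s (- (fcoef a 0)^-1 *
             \sum_(i < n) fcoef a i.+1 * nth 0 s (n' - i))
  else [:: (fcoef a 0)^-1].

Definition fps_unit : {pred fps R} := fun a => fcoef a 0 != 0.

Definition fps_inv a : fps R :=
  if fps_unit a then Fps (fun n => nth 0 (fps_inv_seq a n) n) else a.

Let size_inv_seq a n : size (fps_inv_seq a n) = n.+1.
Proof. by elim: n => //= n IH; rewrite size_rcons IH. Qed.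

Let nth_inv_seq a n k : (k <= n)%N ->
  nth 0 (fps_inv_seq a n) k = nth 0 (fps_inv_seq a k) k.
Proof.
elim: n => [|n IH]; first by rewrite leqn0 => /eqP->.
rewrite leq_eqVlt => /predU1P[->//|]; rewrite ltnS => kn.
by rewrite /= nth_rcons size_inv_seq ltnS kn IH.
Qed.

Lemma fps_mulVx : {in fps_unit, left_inverse 1 fps_inv *%R}.
Proof.
move=> a ua; have a0 : fcoef a 0 != 0 by [].
rewrite mulrC; apply: fpsP => n.
rewrite /fps_inv (_ : fps_unit a = true) //= big_ord_recl /= subn0.
case: n => [|n]; first by rewrite big_ord0 addr0 divff.
rewrite /= nth_rcons size_inv_seq ltnn eqxx mulrA mulrN divff // mulN1r.
apply/eqP; rewrite addrC subr_eq0; apply/eqP; apply: eq_bigr => i _.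
by rewrite /bump /= add1n subSS -(@nth_inv_seq a n) // leq_subr.
Qed.

Lemma fps_unitPl a b : b * a = 1 -> fps_unit a.
Proof.
move=> /(congr1 (fun c => fcoef c 0)) /=.
rewrite big_ord_recl big_ord0 addr0 /= /fps_unit => ba1.
apply/eqP => a0; move/eqP: ba1.
by rewrite a0 mulr0 eq_sym oner_eq0.
Qed.

Lemma fps_inv_out : {in [predC fps_unit], fps_inv =1 id}.
Proof.
move=> a; rewrite inE => /negbTE ua.
by rewrite /fps_inv (ua : fps_unit a = false).
Qed.

HB.instance Definition _ := GRing.ComNzRing_hasMulInverse.Build (fps R)
  fps_mulVx fps_unitPl fps_inv_out.

End FpsRing.

(** * Permutations with a prescribed up-down sequence *)

(** The one-line word of [s] has 0-based positions and values. *)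
Definition word n (s : 'S_n) : seq nat := [seq val (s i) | i <- enum 'I_n].

Definition up_down n (s : 'S_n) : seq bool :=
  mkseq (fun i => nth 0 (word s) i < nth 0 (word s) i.+1)%N n.-1.

(** Position i of [mkseq] stands for p_(i+1). For n = 0 there is no up-down
    sequence (of length -1), but the truncated predecessor makes the code below
    count the empty permutation, i.e. [sharp P 0] = 1.

    A binary sequence (p_1, p_2, ...) is a function [P : nat -> bool] with
    [P k] = p_k for k >= 1; the value [P 0] is never used. *)
Definition sharp (P : nat -> bool) (n : nat) : nat :=
  #|[set s : 'S_n | up_down s == mkseq (fun i => P i.+1) n.-1]|.

(** [(p)^*]: p_k is entry k - 1 of the tuple [p], with k - 1 reduced mod m. *)
Definition periodic m (p : m.-tuple bool) : nat -> bool :=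
  fun k => nth false p (k.-1 %% m).

(** The increasing sequence i_1 < ... < i_r, where r is its size. *)
Definition zeros m (p : m.-tuple bool) : seq nat :=
  [seq k <- iota 1 m | ~~ periodic p k].

(** i_j for 0 <= j <= r, including i_0 = 0. *)
Definition loc m (p : m.-tuple bool) (j : nat) : nat := nth 0%N (0%N :: zeros p) j.

Definition eps (R : nzRingType) (P : nat -> bool) (i : nat) : R :=
  (-1) ^+ (\sum_(1 <= k < i) ~~ P k)%N.

Definition egf (u : nat -> nat) : fps rat := Fps (fun n => (u n)%:R / (n`!)%:R).

(** phi_{m,k}, with the second index k read modulo m: for 0 <= k < m the
    exponents n = k mod m are exactly the jm + k with j >= 0. *)
Definition olivier (m k : nat) : fps rat :=
  Fps (fun n => if n == k %[mod m] then (n`!)%:R^-1 else 0).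

(** The sum is over the i in {0, ..., m-1} that are none of i_0, ..., i_{r-1}
    (i_r = m is out of range), not merely different from the single i_j. *)
Definition psi m (p : m.-tuple bool) (j : nat) : fps rat :=
  eps _ (periodic p) (loc p j).+1 +
  \sum_(0 <= i < m | i \notin 0%N :: zeros p)
     eps _ (periodic p) i.+1 * olivier m (m + i - loc p j).

(** The index m + i_a - i_b is congruent mod m to i_a - i_b, so the entries on
    and below the diagonal are covered by the same formula. *)
Definition Mmat m (p : m.-tuple bool) : 'M[fps rat]_(size (zeros p)) :=
  \matrix_(a, b) olivier m (m + loc p a - loc p b).

(** [Mmat p] is the identity at t = 0 and [psi p 0] is 1 there, so the quotient
    \det (Mtilde p) / \det (Mmat p) has constant term 1. Hence 1 + quotient has
    constant term 2, and can agree with [egf (sharp P)] in positive degrees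
    only. *)
Definition Mtilde m (p : m.-tuple bool) : 'M[fps rat]_(size (zeros p)) :=
  \matrix_(a, b) if a == 0 :> nat then psi p b else Mmat p a b.

(* Main.v *)
Require Import Defs.
From HB Require Import structures.
From mathcomp Require Import all_boot all_order all_algebra all_fingroup.
From mathcomp Require Import ring.
Set Implicit Arguments.
Unset Strict Implicit.
Unset Printing Implicit Defensive.
Import GRing.Theory Num.Theory.
Local Open Scope ring_scope.

(** Let e_n = eps_n sharp_n / n!. Counting the words that follow P on their
    first z letters and increase on the others in two ways gives the recursion
      e_n = 1/n! - sum of e_z / (n - z)! over the zeros z of P with 0 < z < n.
    Split the series 1 - sum_(n > 0) e_n t^n according to the class of n
    modulo m, and let b_j be its part in the class of i_j. The recursion at
    the exponents n congruent to some i_k says that M (b_j) is the first unit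
    vector, so by Cramer's rule det Mtilde / det M = sum_j psi_j b_j. The
    recursion at the other exponents, and the m-periodicity of the signs (this
    is where r even is used), identify this sum with the generating function. *)

(** As [P] is indexed from 1 and positions from 0, [P j] with [j = i.+1] compares
    the entries at positions i and j. *)
Definition pat (P : nat -> bool) n (f : 'I_n -> nat) : bool :=
  [forall i : 'I_n, forall j : 'I_n,
    (j == i.+1 :> nat) ==> ((f i < f j)%N == P j)].

Lemma patP (P : nat -> bool) n (f : 'I_n -> nat) :
  reflect (forall i j : 'I_n, j = i.+1 :> nat -> (f i < f j)%N = P j)
          (pat P f).
Proof.
apply: (iffP forallP) => [H i j e|H i].
  by move/forallP/(_ j): (H i); rewrite e eqxx => /eqP; rewrite -e.
by apply/forallP => j; apply/implyP => /eqP /H ->.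
Qed.

Lemma eq_pat (P : nat -> bool) n (f g : 'I_n -> nat) :
  (forall i j, (f i < f j)%N = (g i < g j)%N) -> pat P f = pat P g.
Proof. by move=> fg; do 2!(apply: eq_forallb => ?); rewrite fg. Qed.

Lemma nth_word n (s : 'S_n) (i : 'I_n) : nth 0%N (word s) i = s i.
Proof. by rewrite (nth_map i) ?size_enum_ord // nth_ord_enum. Qed.

Lemma up_downP (P : nat -> bool) n (s : 'S_n) :
  (up_down s == mkseq (fun i => P i.+1) n.-1) = pat P (fun i => val (s i)).
Proof.
apply/eqP/patP => [H i j e|H].
  have ltin : (i < n.-1)%N.
    by case: (n) i j e => [[]|k] // i j /= <-; apply: (ltn_ord j).
  move/(congr1 (fun w => nth false w i)): H.
  by rewrite !nth_mkseq // -e !nth_word.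
apply: (@eq_from_nth _ false); rewrite !size_mkseq // => i ltin.
rewrite !nth_mkseq //.
have ltn1 : (i.+1 < n)%N by case: (n) ltin.
have := H (Ordinal (ltnW ltn1)) (Ordinal ltn1) (erefl _).
by rewrite /= -!(nth_word s).
Qed.

Lemma sharpE (P : nat -> bool) n :
  sharp P n = #|[set s : 'S_n | pat P (fun i => val (s i))]|.
Proof. by apply: eq_card => s; rewrite !inE up_downP. Qed.

Lemma eq_patl (P Q : nat -> bool) n (f : 'I_n -> nat) :
  (forall i, (0 < i < n)%N -> P i = Q i) -> pat P f = pat Q f.
Proof.
by move=> PQ; apply/patP/patP => H i j e; rewrite H // PQ // ltn_ord e.
Qed.

Lemma eq_sharp (P Q : nat -> bool) n :
  (forall i, (0 < i < n)%N -> P i = Q i) -> sharp P n = sharp Q n.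
Proof.
by move=> PQ; rewrite !sharpE; apply: eq_card => s; rewrite !inE (eq_patl _ PQ).
Qed.

Lemma standardize n (f : 'I_n -> nat) : injective f ->
  exists r : 'S_n, forall i j, (f i < f j)%N = (r i < r j)%N.
Proof.
move=> inj_f.
pose rk (x : 'I_n) := #|[set y : 'I_n | (f y < f x)%N]|.
have rk_lt i j : (f i < f j)%N -> (rk i < rk j)%N.
  move=> ltij; apply/proper_card/properP; split.
    by apply/subsetP => y; rewrite !inE => /ltn_trans; apply.
  by exists i; rewrite !inE ?ltnn.
have rk_mono i j : (f i < f j)%N = (rk i < rk j)%N.
  case: (ltngtP (f i) (f j)) => [/rk_lt->//|/rk_lt/ltnW|/inj_f->].
    by rewrite ltnNge => ->.
  by rewrite ltnn.
have rk_bnd x : (rk x < n)%N.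
  rewrite -[X in (_ < X)%N]card_ord -cardsT; apply/proper_card/properP.
  by split; [apply: subsetT | exists x; rewrite !inE ?ltnn].
have rk_inj : injective (fun x => Ordinal (rk_bnd x)).
  move=> x y [/eqP rxy]; apply/inj_f/eqP; move: rxy.
  by rewrite !eqn_leq ![(f _ <= _)%N]leqNgt !rk_mono -!leqNgt.
by exists (perm rk_inj) => i j; rewrite !permE rk_mono.
Qed.

Lemma card_pat_inj (P : nat -> bool) n (f : 'I_n -> nat) : injective f ->
  #|[set t : 'S_n | pat P (fun i => f (t i))]| = sharp P n.
Proof.
move=> /standardize[r fr]; rewrite sharpE.
rewrite -(card_imset _ (mulIg r)); apply: eq_card => s; rewrite inE.
apply/imsetP/idP => [[t]|Ps].
  rewrite inE => Pt ->; move: Pt; rewrite (@eq_pat _ _ _ (fun i => val ((t * r)%g i))) //.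
  by move=> i j; rewrite !permM fr.
exists (s * r^-1)%g; last by rewrite mulgKV.
rewrite inE (@eq_pat _ _ _ (fun i => val (s i))) // => i j.
by rewrite fr -!permM mulgKV.
Qed.

Lemma sharp_true n : sharp (fun=> true) n = 1%N.
Proof.
rewrite sharpE (_ : [set s | _] = [set 1%g]) ?cards1 //.
apply/setP => s; rewrite !inE; apply/patP/eqP => [H|-> i j e]; last by rewrite !perm1 /= e ltnSn.
have szw : size (word s) = n by rewrite size_map size_enum_ord.
have sw : sorted ltn (word s).
  apply/(sortedP 0%N) => i; rewrite szw => lti.
  by have := H (Ordinal (ltnW lti)) (Ordinal lti) (erefl _); rewrite /= -!(nth_word s).
have ew : word s = iota 0 n.
  apply: (irr_sorted_eq ltn_trans ltnn sw (iota_ltn_sorted 0 n)) => x.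
  rewrite mem_iota /=; apply/mapP/idP => [[i _ ->]|ltx]; first exact: ltn_ord.
  by exists (s^-1 (Ordinal ltx))%g; rewrite ?mem_enum ?permKV.
by apply/permP => i; apply: val_inj; rewrite perm1 /= -nth_word ew nth_iota.
Qed.

Definition block_fun m n (s : 'S_m * 'S_n) (i : 'I_(m + n)) : 'I_(m + n) :=
  unsplit (match split i with inl a => inl (s.1 a) | inr b => inr (s.2 b) end).

Lemma block_fun_inj m n (s : 'S_m * 'S_n) : injective (block_fun s).
Proof.
move=> i j /(can_inj (@unsplitK _ _)) e; apply: (can_inj (@splitK _ _)).
by move: e; case: (split i) => a; case: (split j) => b // [/perm_inj->].
Qed.

Definition block_perm m n (s : 'S_m * 'S_n) : 'S_(m + n) := perm (@block_fun_inj m n s).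

Lemma block_permL m n (s : 'S_m * 'S_n) i :
  block_perm s (lshift n i) = lshift n (s.1 i).
Proof. by rewrite permE /block_fun (unsplitK (inl i)). Qed.

Lemma block_permR m n (s : 'S_m * 'S_n) i :
  block_perm s (rshift m i) = rshift m (s.2 i).
Proof. by rewrite permE /block_fun (unsplitK (inr i)). Qed.

Definition split_pats (P Q : nat -> bool) m n : {set 'S_(m + n)} :=
  [set s : 'S_(m + n) | pat P (fun i => val (s (lshift n i))) &&
           pat Q (fun i => val (s (rshift m i)))].

(** Double counting over 'S_m * 'S_n acting on positions: each permutation has
    [sharp P m * sharp Q n] rearrangements within the two blocks with the
    required patterns. *)
Lemma card_split_pats (P Q : nat -> bool) m n :
  (#|split_pats P Q m n| * (m`! * n`!) = (m + n)`! * (sharp P m * sharp Q n))%N.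
Proof.
have cS k : #|'S_k| = k`! by rewrite card_Sn.
transitivity (\sum_(t : 'S_m * 'S_n) \sum_(s : 'S_(m + n))
   ((block_perm t * s)%g \in split_pats P Q m n))%N.
  rewrite (eq_bigr (fun=> #|split_pats P Q m n|)) => [|t _].
    by rewrite sum_nat_const card_prod !cS mulnC.
  rewrite (reindex_inj (mulgI (block_perm t)^-1)%g) /= -sum1_card [RHS]big_mkcond.
  by apply: eq_bigr => s _; rewrite mulKVg; case: (_ \in _).
rewrite exchange_big /= (eq_bigr (fun=> (sharp P m * sharp Q n)%N)) => [|s _].
  by rewrite sum_nat_const cS.
have injL : injective (fun i => val (s (lshift n i))).
  by move=> i j /val_inj/perm_inj/lshift_inj.
have injR : injective (fun i => val (s (rshift m i))).
  by move=> i j /val_inj/perm_inj/rshift_inj.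
rewrite -(card_pat_inj P injL) -(card_pat_inj Q injR) -cardsX -sum1_card [RHS]big_mkcond.
apply: eq_bigr => t _; rewrite !inE.
rewrite (_ : pat P _ = pat P (fun i => val (s (lshift n (t.1 i))))); last first.
  by apply: eq_pat => i j; rewrite !permM !block_permL.
rewrite (_ : pat Q _ = pat Q (fun i => val (s (rshift m (t.2 i))))); last first.
  by apply: eq_pat => i j; rewrite !permM !block_permR.
by case: (_ && _).
Qed.

Lemma pat_split (P : nat -> bool) m n (f : 'I_(m.+1 + n.+1) -> nat) :
  pat P f = [&& pat P (fun i => f (lshift n.+1 i)),
                pat (fun i => P (m.+1 + i)%N) (fun i => f (rshift m.+1 i)) &
                (f (lshift n.+1 ord_max) < f (rshift m.+1 ord0))%N == P m.+1].
Proof.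
apply/patP/and3P => [H|[/patP Hl /patP Hr /eqP Hm] i j].
  split; last by rewrite (H _ (rshift m.+1 ord0)) /= addn0.
    by apply/patP => i j e; apply: H.
  by apply/patP => i j e; apply: H; rewrite /= e addnS.
case: (split_ordP i) => a ->; case: (split_ordP j) => b -> /=; first exact: Hl.
- move=> e.
  have -> : a = ord_max.
    by apply/val_inj/eqP; rewrite /= eqn_leq -ltnS ltn_ord /= -ltnS -e leq_addr.
  have -> : b = ord0.
    by apply/val_inj/eqP; rewrite /= -leqn0 -(leq_add2l m.+1) addn0 e ltn_ord.
  by rewrite addn0.
- by move=> e; have := ltn_ord b; rewrite e ltnNge leqW ?leq_addr.
- by rewrite -addnS => /addnI /Hr.
Qed.

Definition up_from (P : nat -> bool) k i := (i < k)%N ==> P i.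

Lemma card_split_up (P : nat -> bool) z k : (0 < z)%N -> (0 < k)%N -> ~~ P z ->
  #|split_pats P (fun=> true) z k| =
  (sharp (up_from P z) (z + k) + sharp (up_from P z.+1) (z + k))%N.
Proof.
case: z k => [|z] [|k] // _ _ /negbTE Pz; rewrite !sharpE.
pose up (s : 'S_(z.+1 + k.+1)) := (s (lshift k.+1 ord_max) < s (rshift z.+1 ord0))%N.
have leftE Q : {in [pred i | i < z.+1]%N, Q =1 P} ->
    forall f : 'I_z.+1 -> nat, pat Q f = pat P f.
  by move=> QP f; apply: eq_patl => i /andP[_ lti]; apply: QP.
have rightE j : (j <= z.+2)%N -> forall f : 'I_k.+1 -> nat,
    pat (fun i => up_from P j (z.+1 + i)) f = pat xpredT f.
  move=> lej f; apply: eq_patl => -[|i] // _; rewrite /up_from ltnNge.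
  by rewrite (leq_trans lej) // addSn addnS leq_addr.
rewrite -[LHS](cardsID [set s | up s]); congr (_ + _)%N; apply: eq_card => s;
  rewrite !inE pat_split rightE // -/(up s) leftE /up_from ?ltnn ?leqnn ?Pz;
  try by move=> i; rewrite inE => lti; rewrite ?lti // ltnW.
  by rewrite eqb_id andbA.
by rewrite eqbF_neg andbC andbA.
Qed.

Lemma epsS (R : nzRingType) (P : nat -> bool) i : (0 < i)%N ->
  eps R P i.+1 = eps R P i * (-1) ^+ (~~ P i).
Proof. by move=> i0; rewrite /eps big_nat_recr //= exprD. Qed.

Lemma eps_sq (R : nzRingType) (P : nat -> bool) i : eps R P i * eps R P i = 1.
Proof. by rewrite /eps -expr2 sqrr_sign. Qed.

Definition signed_egf (P : nat -> bool) n : rat :=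
  eps _ P n * fcoef (egf (sharp P)) n.

Lemma fact_neq0 n : (n`!)%:R != 0 :> rat.
Proof. by rewrite pnatr_eq0 -lt0n fact_gt0. Qed.

Lemma up_from_telescope (P : nat -> bool) n j : (0 < j <= n)%N ->
  eps rat P j * ((sharp (up_from P j) n)%:R / (n`!)%:R) =
  (n`!)%:R^-1 - \sum_(1 <= z < j | ~~ P z) signed_egf P z / ((n - z)`!)%:R.
Proof.
elim: j => [//|[|j] IHj] /andP[_ lejn].
  rewrite big_geq // subr0 (eq_sharp (Q := xpredT)) => [|[|i]//].
  by rewrite sharp_true /eps big_geq // !mul1r.
rewrite epsS // big_mkcond big_nat_recr //= -big_mkcond opprD addrA.
rewrite -IHj ?(ltnW lejn) //; case: ifP => [Pj|/negbFE Pj]; last first.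
  rewrite mulr1 subr0; congr (_ * (_%:R / _)); apply: eq_sharp => i _.
  rewrite /up_from ltnS leq_eqVlt; case: eqP => [->|//].
  by rewrite Pj !implybT.
rewrite mulrN1 mulNr -[RHS]opprB; congr (- _).
have := card_split_pats P xpredT j.+1 (n - j.+1).
rewrite card_split_up ?subn_gt0 // subnKC; last exact: ltnW.
rewrite sharp_true muln1 => /(congr1 (fun k => k%:R : rat)).
rewrite natrM natrD [X in _ * X]natrM [RHS]natrM => E; rewrite /signed_egf /= -!mulrA -mulrBr.
congr (_ * _).
have -> : (sharp P j.+1)%:R = ((sharp (up_from P j.+1) n)%:R + (sharp (up_from P j.+2) n)%:R)
   * (((j.+1)`!)%:R * ((n - j.+1)`!)%:R) / (n`!)%:R :> rat.
  by rewrite E mulrC mulKf ?fact_neq0.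
have H1 := fact_neq0 j.+1; have H2 := fact_neq0 (n - j.+1); have H3 := fact_neq0 n.
by field; rewrite H1 H2 H3.
Qed.

Lemma signed_egf_rec (P : nat -> bool) n : (0 < n)%N ->
  signed_egf P n =
  (n`!)%:R^-1 - \sum_(1 <= z < n | ~~ P z) signed_egf P z / ((n - z)`!)%:R.
Proof.
move=> n0; rewrite -up_from_telescope ?n0 //= /signed_egf /=.
congr (_ * (_%:R / _)); apply: eq_sharp => i /andP[_ lti].
by rewrite /up_from lti.
Qed.

Lemma det_row_replace (R : comNzRingType) n (M N : 'M[R]_n) (v : 'cV[R]_n) i0 :
  (forall i j, i != i0 -> N i j = M i j) -> M *m v = delta_mx i0 0 ->
  \det N = \det M * \sum_j N i0 j * v j 0.
Proof.
move=> NM Mv; rewrite (expand_det_row N i0) mulr_sumr; apply: eq_bigr => j _.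
have -> : cofactor N i0 j = (\adj M) j i0.
  rewrite mxE; congr (_ * \det _); apply/matrixP => a b.
  by rewrite !mxE NM // eq_sym neq_lift.
suff -> : (\adj M) j i0 = \det M * v j 0 by rewrite mulrCA.
have /matrixP/(_ j 0) := congr1 (mulmx (\adj M)) Mv.
rewrite mulmxA mul_adj_mx mul_scalar_mx [LHS]mxE => ->.
rewrite [RHS]mxE (bigD1 i0) //= big1 => [|k ki].
  by rewrite !mxE !eqxx mulr1 addr0.
by rewrite !mxE (negbTE ki) mulr0.
Qed.

Lemma fcoef_sum (R : fieldType) I (s : seq I) (Q : pred I) (F : I -> fps R) n :
  fcoef (\sum_(i <- s | Q i) F i) n = \sum_(i <- s | Q i) fcoef (F i) n.
Proof. exact: (big_morph (fun a => fcoef a n)). Qed.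

Lemma fcoef_eps (R : fieldType) (P : nat -> bool) i (a : fps R) n :
  fcoef (eps _ P i * a) n = eps _ P i * fcoef a n.
Proof.
rewrite /eps -[in LHS]signr_odd -[in RHS]signr_odd.
by case: odd; rewrite ?mul1r ?mulN1r.
Qed.

Section ConstantTerm.
Variable R : fieldType.

Definition const_term (a : fps R) := fcoef a 0.

Let const_termB : zmod_morphism const_term. Proof. by []. Qed.
Let const_termM : monoid_morphism const_term.
Proof. by split=> // a b; rewrite /const_term /= big_ord1. Qed.

HB.instance Definition _ := GRing.isZmodMorphism.Build _ _ const_term const_termB.
HB.instance Definition _ := GRing.isMonoidMorphism.Build _ _ const_term const_termM.

End ConstantTerm.

Lemma periodicD m (p : m.-tuple bool) k : (0 < k)%N ->
  periodic p (k + m) = periodic p k.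
Proof. by case: k => // k _; rewrite /periodic addSn /= modnDr. Qed.

Lemma periodic_mod m (p : m.-tuple bool) k : (0 < k %% m)%N ->
  periodic p k = periodic p (k %% m).
Proof.
rewrite [in periodic p k](divn_eq k m) addnC; move: (k %% m)%N => i i0.
elim: (k %/ m)%N => [|q IHq]; first by rewrite addn0.
by rewrite mulSnr addnA periodicD // addn_gt0 i0.
Qed.

Section Zeros.
Variables (m : nat) (p : m.-tuple bool).
Hypotheses (hm : (1 < m)%N) (hlast : loc p (size (zeros p)) = m).
Local Notation r := (size (zeros p)).
Local Notation P := (periodic p).
Local Notation L := (0%N :: zeros p).

Let m0 : (0 < m)%N. Proof. exact: ltnW. Qed.

Lemma mem_zeros k : (k \in zeros p) = (0 < k <= m)%N && ~~ P k.
Proof. by rewrite mem_filter mem_iota ltnS andbC. Qed.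

Lemma sorted_loc : sorted ltn L.
Proof.
apply: (subseq_sorted ltn_trans) (iota_ltn_sorted 0 m.+1).
exact: filter_subseq.
Qed.

Lemma loc_lt j : (j < r)%N -> (loc p j < m)%N.
Proof.
move=> ltj; rewrite -[X in (_ < X)%N]hlast.
by apply: (sorted_ltn_nth ltn_trans 0%N sorted_loc) => //; rewrite inE /= ltnS // ltnW.
Qed.

Lemma zeros_gt0 : (0 < r)%N.
Proof. by rewrite lt0n; apply/eqP => r0; move: hlast hm; rewrite r0 => <-. Qed.

Lemma loc_inj j k : (j < r)%N -> (k < r)%N -> (loc p j == loc p k) = (j == k).
Proof.
move=> ltj ltk; apply: nth_uniq; rewrite /= ?ltnS; try exact: ltnW.
exact: sorted_uniq ltn_trans ltnn _ sorted_loc.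
Qed.

Lemma index_lt i : (i < m)%N -> i \in L -> (index i L < r)%N.
Proof.
move=> ltim iL; rewrite ltn_neqAle -ltnS -[r.+1]/(size L) index_mem iL andbT.
by apply: contraTneq ltim => ei; rewrite -(nth_index 0%N iL) ei -/(loc p r) hlast ltnn.
Qed.

Lemma sum_loc (V : nmodType) (F : nat -> V) i : (i < m)%N ->
  \sum_(j < r) (if i == loc p j then F j else 0) =
  if i \in L then F (index i L) else 0.
Proof.
move=> ltim; case: ifP => iL; last first.
  apply: big1 => j _; case: eqP => // ij; move: iL.
  by rewrite ij mem_nth // ltnS ltnW.
have ltr := index_lt ltim iL; have il : loc p (index i L) = i by apply: nth_index.
rewrite (bigD1 (Ordinal ltr)) //= -{1}il eqxx big1 ?addr0 // => j; rewrite -val_eqE /= => ji.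
by rewrite -{1}il loc_inj // eq_sym (negbTE ji).
Qed.

Lemma mod_loc k : ((k %% m)%N \in L) = (k == 0%N) || ~~ P k.
Proof.
have Pm : ~~ P m.
  have : m \in zeros p.
    rewrite -[X in X \in _]hlast /loc; case: (zeros p) zeros_gt0 => // a s _.
    exact: (@mem_nth _ 0%N (a :: s) (size s)).
  by rewrite mem_zeros => /andP[].
rewrite inE mem_zeros; case: posnP => [k0|k0] /=.
  have -> : k = (k %/ m * m)%N by rewrite {1}(divn_eq k m) k0 addn0.
  case: (k %/ m)%N => // q; rewrite mulSn addn_eq0 -[m == 0%N]negbK -lt0n m0 /=.
  by elim: q => [|q IHq]; rewrite ?addn0 // mulSnr addnA periodicD // addn_gt0 m0.
rewrite (ltnW (ltn_pmod _ m0)) -periodic_mod //=.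
by case: k k0 => //; rewrite mod0n.
Qed.

Lemma eps_mod (R : nzRingType) n : ~~ odd r ->
  eps R P n.+1 = eps R P (n %% m).+1.
Proof.
move=> ev; rewrite [in LHS](divn_eq n m) addnC; move: (n %% m)%N => i.
have step k : eps R P (k + m).+1 = eps R P k.+1.
  elim: k => [|k IHk]; last first.
    by rewrite addSn [LHS]epsS // IHk -addSn periodicD // -epsS.
  rewrite /eps (big_geq (n := 1)) // add0n -[RHS]/1.
  suff -> : (\sum_(1 <= k < m.+1) ~~ P k)%N = r by rewrite -signr_odd (negbTE ev).
  by rewrite size_filter -sum1_count [RHS]big_mkcond /index_iota subn1; apply: eq_bigr => k _; case: P.
elim: (n %/ m)%N => [|q IHq]; first by rewrite addn0.
by rewrite mulSnr addnA step.
Qed.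

Definition loc_coef n : rat := if n == 0%N then 1 else - signed_egf P n.

Definition loc_series j : fps rat :=
  Fps (fun n => if n == loc p j %[mod m] then loc_coef n else 0).

Lemma loc_series_olivier j i n : (j < r)%N ->
  fcoef (loc_series j * olivier m (m + i - loc p j)) n =
  if n == i %[mod m] then
    \sum_(k < n.+1) (if (k %% m)%N == loc p j then loc_coef k / ((n - k)`!)%:R else 0)
  else 0.
Proof.
move=> /loc_lt ltj.
transitivity (\sum_(k < n.+1) if n == i %[mod m] then
    if (k %% m)%N == loc p j then loc_coef k / ((n - k)`!)%:R else 0 else 0);
  last by case: eqP => // _; rewrite big1.
apply: eq_bigr => k _ /=; rewrite [(loc p j %% m)%N]modn_small //.
case: (eqVneq (k %% m)%N) => [kj|_]; last by rewrite mul0r if_same.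
suff -> : (n - k == m + i - loc p j %[mod m]) = (n == i %[mod m]).
  by case: ifP; rewrite ?mulr0.
rewrite -(eqn_modDr k) subnK -1?ltnS //; congr (_ == _).
by rewrite -modnDmr kj subnK ?modnDl // (leq_trans (ltnW ltj)) ?leq_addr.
Qed.

Lemma sum_loc_series_olivier i n : (i < m)%N ->
  \sum_(j < r) fcoef (loc_series j * olivier m (m + i - loc p j)) n =
  if (n %% m)%N == i then
    if n == 0%N then 1 else if (n %% m)%N \in L then 0 else signed_egf P n
  else 0.
Proof.
move=> ltim.
under eq_bigr do rewrite loc_series_olivier // [(i %% m)%N]modn_small //.
case: ifP => _; last by rewrite big1.
rewrite exchange_big /=.
under eq_bigr do rewrite (sum_loc (fun=> _)) ?ltn_pmod // mod_loc.
rewrite mod_loc; case: n => [|n]; first by rewrite big_ord1 /= divr1.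
rewrite -(big_mkord xpredT (fun k => if (k == 0%N) || ~~ P k then
  loc_coef k / ((n.+1 - k)`!)%:R else 0)) big_nat_recl //= big_nat_recr //=.
rewrite subnn fact0 divr1 {1}/loc_coef /= mul1r addrA.
have -> : \sum_(0 <= k < n) (if ~~ P k.+1 then loc_coef k.+1 / ((n.+1 - k.+1)`!)%:R else 0) =
    - \sum_(1 <= z < n.+1 | ~~ P z) signed_egf P z / ((n.+1 - z)`!)%:R.
  rewrite [in RHS]big_mkcond big_add1 -sumrN; apply: eq_bigr => k _.
  by case: ifP; rewrite ?oppr0 // mulNr.
by rewrite -signed_egf_rec //; case: ifP; rewrite ?addr0 // /loc_coef /= subrr.
Qed.

Lemma Mmat_loc_series (i0 : 'I_r) : i0 = 0%N :> nat ->
  Mmat p *m (\col_j loc_series j) = delta_mx i0 0.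
Proof.
move=> i00; apply/matrixP => a b; rewrite !mxE [b]ord1 andbT.
under eq_bigr do rewrite !mxE mulrC.
apply: fpsP => n; rewrite fcoef_sum sum_loc_series_olivier ?loc_lt //.
have aL : loc p a \in L by rewrite mem_nth // ltnS ltnW.
have -> : (a == i0) = (loc p a == 0)%N.
  by rewrite -[0%N in RHS]/(loc p 0) loc_inj ?zeros_gt0 // -i00.
have -> : fcoef (loc p a == 0%N)%:R n = ((loc p a == 0) && (n == 0))%N%:R :> rat.
  by case: (_ == _); case: (n).
case: (eqVneq (n %% m)%N (loc p a)) => [nla|nla].
  by rewrite nla aL; case: (n) nla => [<-|k _]; rewrite ?mod0n ?andbF.
case: (n) nla => [|k] nla; last by rewrite andbF.
by rewrite mod0n eq_sym in nla; rewrite (negbTE nla).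
Qed.

Lemma Mmat_unit : \det (Mmat p) \is a GRing.unit.
Proof.
suff : const_term (\det (Mmat p)) != 0 by [].
rewrite -det_map_mx (_ : map_mx _ _ = 1%:M) ?det1 ?oner_eq0 //.
apply/matrixP => a b; rewrite !mxE /const_term /= fact0 invr1.
rewrite -val_eqE -[a == b :> nat]loc_inj //=.
suff -> : (0 == m + loc p a - loc p b %[mod m]) = (loc p a == loc p b) by case: eqP.
rewrite -(eqn_modDr (loc p b)) add0n subnK; last first.
  by rewrite (leq_trans (ltnW (loc_lt _))) ?leq_addr.
by rewrite modnDl !modn_small ?loc_lt // eq_sym.
Qed.

Lemma fcoef_psi_loc_series n : ~~ odd r -> (0 < n)%N ->
  fcoef (\sum_(j < r) psi p j * loc_series j) n = fcoef (egf (sharp P)) n.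
Proof.
move=> ev n0.
have inv_eps : fcoef (egf (sharp P)) n = eps _ P n * signed_egf P n.
  by rewrite mulrA eps_sq mul1r.
have -> : fcoef (\sum_(j < r) psi p j * loc_series j) n =
    \sum_(j < r) fcoef (eps _ P (loc p j).+1 * loc_series j) n +
    \sum_(0 <= i < m | i \notin L) eps _ P i.+1 *
      \sum_(j < r) fcoef (loc_series j * olivier m (m + i - loc p j)) n.
  under eq_bigr do rewrite mulrDl mulr_suml.
  rewrite big_split exchange_big /=; congr (_ + _); rewrite fcoef_sum //.
  apply: eq_bigr => i _; rewrite fcoef_sum mulr_sumr; apply: eq_bigr => j _.
  by rewrite -mulrA fcoef_eps [olivier _ _ * _]mulrC.
have ltn : (n %% m < m)%N by rewrite ltn_pmod.
have -> : \sum_(j < r) fcoef (eps _ P (loc p j).+1 * loc_series j) n =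
    if (n %% m)%N \in L then eps _ P n.+1 * loc_coef n else 0.
  rewrite -(sum_loc (fun=> eps _ P n.+1 * loc_coef n)) //.
  apply: eq_bigr => j _; rewrite fcoef_eps /= [(loc p j %% m)%N]modn_small ?loc_lt //.
  by case: eqP => [nj|]; rewrite ?mulr0 // -nj -eps_mod.
have -> : \sum_(0 <= i < m | i \notin L) eps _ P i.+1 *
      \sum_(j < r) fcoef (loc_series j * olivier m (m + i - loc p j)) n =
    if (n %% m)%N \in L then 0 else eps _ P n.+1 * signed_egf P n.
  rewrite big_mkord; under eq_bigr do rewrite sum_loc_series_olivier //.
  rewrite big_mkcond (bigD1 (Ordinal ltn)) //= big1 => [|i].
    rewrite eqxx addr0 -eps_mod // eqn0Ngt n0 /=.
    by case: (_ \in _).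
  by rewrite -val_eqE /= eq_sym => /negbTE ->; rewrite mulr0 if_same.
rewrite inv_eps epsS // mod_loc /loc_coef eqn0Ngt n0 /=.
by case: (P n); rewrite /= ?add0r ?addr0 ?mulr1 // mulrN1 mulrNN.
Qed.

End Zeros.

Theorem corollary1 (m : nat) (p : m.-tuple bool) (hm : (1 < m)%N)
    (hlast : loc p (size (zeros p)) = m)
    (heven : ~~ odd (size (zeros p))) :
  \det (Mmat p) \is a GRing.unit /\
  forall n : nat, (0 < n)%N ->
    fcoef (egf (sharp (periodic p))) n =
    fcoef (1 + \det (Mtilde p) / \det (Mmat p)) n.
Proof.
have M_unit := Mmat_unit hlast; split=> // n n0.
have -> (a : fps rat) : fcoef (1 + a) n = fcoef a n.
  by rewrite -[LHS]/((n == 0%N)%:R + fcoef a n) eqn0Ngt n0 add0r.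
pose i0 := Ordinal (zeros_gt0 hm hlast).
rewrite (det_row_replace (M := Mmat p) (v := \col_j loc_series p j) (i0 := i0)).
- rewrite mulrC mulKr // -(fcoef_psi_loc_series hm hlast heven n0).
  by congr (fcoef _ n); apply: eq_bigr => j _; rewrite !mxE.
- by move=> i j; rewrite -val_eqE /= [LHS]mxE => /negbTE ->.
- exact: Mmat_loc_series.
Qed.
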